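(* Let $K\ge1$ be an integer and let $\bm\Phi=(\phi_1,\dots,\phi_K)$ satisfy $\phi_k\ge0$ for all $k$ and $\sum_{k=1}^K\phi_k=K$. Then $$\frac1K\le\varpi_\eta(\bm\Phi):=\frac{\sum_{k=1}^K\phi_k^4}{\big(\sum_{k=1}^K\phi_k^2\big)^2}\le1,$$ with the lower bound achieved when $\bm\Phi=(1,1,\dots,1)$ and the upper bound achieved when $\bm\Phi=(K,0,0,\dots,0)$. In addition, $$\frac1{K^2}\le\varpi_\epsilon(\bm\Phi):=\frac1{\sum_{k=1}^K\phi_k^2}\le\frac1K,$$ with the lower bound achieved when $\bm\Phi=(K,0,0,\dots,0)$ and the upper bound achieved when $\bm\Phi=(1,1,\dots,1)$.
   Context: $\bm\Phi$ is the power spectrum of a signal source over $K$ frequency bands, normalized so that the total power is $K$; $\varpi_\eta$ and $\varpi_\epsilon$ are functions of $\bm\Phi$. *)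

(* Defs.v *)
From HB Require Import structures.
From mathcomp Require Import all_boot all_order all_algebra.

Set Implicit Arguments.
Unset Strict Implicit.
Unset Printing Implicit Defensive.

Import Order.TTheory GRing.Theory Num.Theory.
Local Open Scope ring_scope.

(* The total power is normalized to the number K of frequency bands. *)
Definition power_spectrum (R : realFieldType) (K : nat) (Phi : 'rV[R]_K) : Prop :=
  (forall k : 'I_K, 0 <= Phi 0 k) /\ \sum_(k < K) Phi 0 k = K%:R.

Definition varpi_eta (R : realFieldType) (K : nat) (Phi : 'rV[R]_K) : R :=
  (\sum_(k < K) Phi 0 k ^+ 4) / (\sum_(k < K) Phi 0 k ^+ 2) ^+ 2.

Definition varpi_epsilon (R : realFieldType) (K : nat) (Phi : 'rV[R]_K) : R :=
  1 / \sum_(k < K) Phi 0 k ^+ 2.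

Definition flat_spectrum (R : realFieldType) (K : nat) : 'rV[R]_K :=
  \row_(k < K) 1.

Definition single_band_spectrum (R : realFieldType) (K : nat) : 'rV[R]_K :=
  \row_(k < K) (if (k : nat) == 0%N then K%:R else 0).

(* Main.v *)
(** With P_m the m-th power sum of Phi, so that P_1 = K, nonnegativity of the
    terms gives P_2 <= P_1^2 and P_4 <= P_2^2, while Cauchy-Schwarz gives
    P_1^2 <= K P_2 and P_2^2 <= K P_4. *)
Require Import Defs.
From HB Require Import structures.
From mathcomp Require Import all_boot all_order all_algebra.
From mathcomp Require Import ring.

Set Implicit Arguments.
Unset Strict Implicit.
Unset Printing Implicit Defensive.

Import Order.TTheory GRing.Theory Num.Theory.
Local Open Scope ring_scope.

(** Two inequalities, [sum_sqr_le_sqr_sum] and [sqr_sum_le_sum_sqr], are each used twice. For [Phi],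
    whose sum is [K], they give [K <= P2 <= K ^+ 2], and inverting bounds [varpi_epsilon]. For the
    squares of [Phi] they enclose [P4 / P2 ^+ 2], which is [varpi_eta]. At the two extremal spectra
    every power sum is explicit. *)

(** Each [f i] is at most the whole sum, so multiplying by [f i] and summing suffices. *)
Lemma sum_sqr_le_sqr_sum (R : realDomainType) (n : nat) (f : 'I_n -> R) :
  (forall i, 0 <= f i) -> \sum_i f i ^+ 2 <= (\sum_i f i) ^+ 2.
Proof.
move=> f_ge0; rewrite [leRHS]expr2 mulr_suml; apply: ler_sum => i _.
rewrite expr2 ler_wpM2l // (bigD1 i) //= lerDl.
exact: sumr_ge0.
Qed.

Lemma sqr_sum_le_sum_sqr (R : realDomainType) (n : nat) (f : 'I_n -> R) :
  (\sum_i f i) ^+ 2 <= n%:R * \sum_i f i ^+ 2.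
Proof.
case: n f => [|n] f; first by rewrite !big_ord0 expr0n mulr0.
set S := \sum_i f i; set N := n.+1%:R : R.
have N_gt0 : 0 < N by rewrite ltr0n.
(* S / N is the mean of f, so this is the variance with denominators cleared. *)
have : 0 <= \sum_i (N * f i - S) ^+ 2 by apply: sumr_ge0 => i _; exact: sqr_ge0.
under eq_bigr => i _.
  rewrite (_ : _ ^+ 2 = N ^+ 2 * f i ^+ 2 + (- (2 * N * S) * f i + S ^+ 2)); last by ring.
  over.
rewrite !big_split /= -!mulr_sumr -/S sumr_const card_ord -mulr_natl -/N.
(* The cross term is [- 2 * N * S ^+ 2], as [f] sums to [S]; the positive factor [N] then
   cancels. *)
rewrite (_ : _ + _ = N * (N * \sum_i f i ^+ 2 - S ^+ 2)); last by ring.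
by rewrite pmulr_rge0 // subr_ge0.
Qed.

Lemma sum_flat_spectrum (R : realFieldType) (K m : nat) :
  \sum_(k < K) flat_spectrum R K 0 k ^+ m = K%:R.
Proof.
under eq_bigr do rewrite mxE expr1n.
by rewrite sumr_const card_ord.
Qed.

Lemma sum_single_band_spectrum (R : realFieldType) (K m : nat) :
  (0 < K)%N -> (0 < m)%N ->
  \sum_(k < K) single_band_spectrum R K 0 k ^+ m = K%:R ^+ m.
Proof.
case: K => // K _ m_gt0; rewrite big_ord_recl mxE /= big1 ?addr0 // => i _.
(* Since [0 ^+ 0 = 1], the empty bands vanish only because [m] is positive. *)
by rewrite mxE expr0n gtn_eqF.
Qed.

Theorem proposition1 (R : realFieldType) (K : nat) (hK : (1 <= K)%N) :
  [/\ forall Phi : 'rV[R]_K, power_spectrum Phi ->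
        1 / K%:R <= varpi_eta Phi <= 1 /\
        1 / K%:R ^+ 2 <= varpi_epsilon Phi <= 1 / K%:R,
      power_spectrum (flat_spectrum R K) /\
        power_spectrum (single_band_spectrum R K),
      varpi_eta (flat_spectrum R K) = 1 / K%:R /\
        varpi_eta (single_band_spectrum R K) = 1
    & varpi_epsilon (single_band_spectrum R K) = 1 / K%:R ^+ 2 /\
        varpi_epsilon (flat_spectrum R K) = 1 / K%:R].
Proof.
have K_gt0 : 0 < K%:R :> R by rewrite ltr0n.
have K_neq0 : K%:R != 0 :> R by rewrite gt_eqF.
split.
- move=> Phi [Phi_ge0 sumPhi]; rewrite /varpi_eta /varpi_epsilon.
  have := sum_sqr_le_sqr_sum Phi_ge0.
  have := sqr_sum_le_sum_sqr (fun k => Phi 0 k).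
  have := sum_sqr_le_sqr_sum (fun k => sqr_ge0 (Phi 0 k)).
  have := sqr_sum_le_sum_sqr (fun k => Phi 0 k ^+ 2).
  have -> : \sum_k (Phi 0 k ^+ 2) ^+ 2 = \sum_k Phi 0 k ^+ 4.
    by apply: eq_bigr => k _; rewrite -exprM.
  rewrite sumPhi.
  set P2 := \sum_(k < K) Phi 0 k ^+ 2; set P4 := \sum_(k < K) Phi 0 k ^+ 4.
  move=> P4_ge P4_le; rewrite [leLHS]expr2 ler_pM2l // => P2_ge P2_le.
  (* Both denominators are thus positive, so inverting reverses the bounds on [P2]. *)
  have P2_gt0 : 0 < P2 := lt_le_trans K_gt0 P2_ge.
  rewrite !div1r lef_pV2 ?posrE ?exprn_gt0 // P2_le.
  rewrite lef_pV2 ?posrE // P2_ge ler_pdivrMr ?exprn_gt0 // mul1r P4_le.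
  by rewrite ler_pdivlMr ?exprn_gt0 // ler_pdivrMl // P4_ge.
- split; split=> [k|].
  + by rewrite mxE ler01.
  (* The normalization is the first power sum, [x ^+ 1] being convertible to [x]. *)
  + exact: (sum_flat_spectrum R K 1).
  + by rewrite mxE; case: ifP => // _; exact: ltW.
  + exact: (sum_single_band_spectrum R (m := 1)).
- rewrite /varpi_eta !sum_flat_spectrum !sum_single_band_spectrum //.
  by rewrite -exprM divff ?expf_neq0 //; split=> //; field.
- by rewrite /varpi_epsilon sum_flat_spectrum sum_single_band_spectrum.
Qed.
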